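(* If the Gramian $P_T=\sum_{i=1}^\infty\int_0^TZ_{i,T}(s)\,\mathrm ds$ exists, then it satisfies $$\sum_{i=1}^\infty Z_{i,T}(T)-BB^\top=\mathcal L(P_T)+H(P_T\otimes P_T)H^\top.$$ If $\sigma\big(A\otimes I+I\otimes A+\sum_{k=1}^mN_k\otimes N_k\big)\subset\mathbb C_-$ and $P=\sum_{i=1}^\infty\int_0^\infty Z_{i,\infty}(s)\,\mathrm ds$ is well-defined, then $P$ is a solution of $$-BB^\top=\mathcal L(P)+H(P\otimes P)H^\top.$$
   Context: Setting: $n,m\in\mathbb N$, $T>0$, $A\in\mathbb R^{n\times n}$, $B\in\mathbb R^{n\times m}$, $N=[N_1\ \dots\ N_m]$, $H=[H_1\ \dots\ H_n]$ with $N_k,H_j\in\mathbb R^{n\times n}$; $\otimes$ is the Kronecker product; $\sigma(\cdot)$ is the spectrum and $\mathbb C_-$ the open left half-plane. $\mathcal L(X)=AX+XA^\top+N(I\otimes X)N^\top=AX+XA^\top+\sum_{k=1}^mN_kXN_k^\top$. $Z_{1,T}$ solves $\dot Z_{1,T}(t)=\mathcal L(Z_{1,T}(t))$, $t\ge0$, $Z_{1,T}(0)=BB^\top$, and for $i\ge2$, $\dot Z_{i,T}(t)=\mathcal L(Z_{i,T}(t))$, $Z_{i,T}(0)=H\big(\sum_{k=1}^{i-1}\int_0^TZ_{k,T}(s)\,\mathrm ds\otimes\int_0^TZ_{i-k,T}(s)\,\mathrm ds\big)H^\top$. $Z_{i,\infty}$ is defined in the same way with $T$ replaced by $\infty$ in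 the initial values. A Gramian ''exists''/''is well-defined'' if the defining series (and, for $P$, all improper integrals) converge. *)

(* Defs.v *)
From HB Require Import structures.
From mathcomp Require Import all_boot all_order all_algebra.
From mathcomp Require Import all_classical all_reals all_analysis.
From mathcomp Require Import complex mxtens.
Import Order.TTheory GRing.Theory Num.Theory.
Import numFieldNormedType.Exports.

Set Implicit Arguments.
Unset Strict Implicit.
Unset Printing Implicit Defensive.

Local Open Scope classical_set_scope.
Local Open Scope ring_scope.

(** [F_0 ... F_(p-1)], with columns indexed as in the Kronecker product
    [tensmx], so that [block_row F] can be multiplied by [_ *t X]. *)
Definition block_row (R : Type) (p n : nat) (F : 'I_p -> 'M[R]_n) :
    'M[R]_(n, p * n) :=
  \matrix_(i, j) F (mxtens_unindex j).1 i (mxtens_unindex j).2.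

Definition lyap (R : pzRingType) (n m : nat) (A : 'M[R]_n)
    (N : 'I_m -> 'M[R]_n) (X : 'M[R]_n) : 'M[R]_n :=
  A *m X + X *m A^T
  + block_row N *m ((1%:M : 'M[R]_m) *t X) *m (block_row N)^T.

Lemma lyapE (R : pzRingType) (n m : nat) (A : 'M[R]_n)
    (N : 'I_m -> 'M[R]_n) (X : 'M[R]_n) :
  lyap A N X = A *m X + X *m A^T + \sum_k N k *m X *m (N k)^T.
Proof.
have sum_tens (G : 'I_(m * n) -> R) :
    \sum_l G l = \sum_k \sum_j G (mxtens_index (k, j)).
  rewrite pair_big /= (reindex (@mxtens_index m n)) /=; last first.
    exists (@mxtens_unindex m n) => x _;
    [exact: mxtens_indexK | exact: mxtens_unindexK].
  by apply: eq_bigr => -[].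
rewrite /lyap; congr (_ + _); apply/matrixP => a b.
rewrite mxE sum_tens summxE; apply: eq_bigr => k _.
rewrite mxE; apply: eq_bigr => j _.
rewrite !mxE mxtens_indexK /=; congr (_ * _).
rewrite sum_tens (bigD1 k) //= [X in _ + X]big1 ?addr0; last first.
  move=> l lk; apply: big1 => i _.
  by rewrite !mxE !mxtens_indexK /= (negbTE lk) mul0r mulr0.
by apply: eq_bigr => i _; rewrite !mxE !mxtens_indexK /= eqxx mul1r.
Qed.

Definition lyap_kron (R : pzRingType) (n m : nat) (A : 'M[R]_n)
    (N : 'I_m -> 'M[R]_n) : 'M[R]_(n * n) :=
  A *t 1%:M + 1%:M *t A + \sum_k N k *t N k.

Definition spectrum (R : rcfType) (p : nat) (M : 'M[R]_p) : set R[i] :=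
  [set z | eigenvalue (map_mx (real_complex R) M) z].

Definition open_left_half_plane (R : rcfType) : set R[i] :=
  [set z | complex.Re z < 0].

(** [f] has derivative [d] at [t] as a function on [0, +oo[: for [0 < t] this is
    the usual derivative, at [t = 0] the right one. *)
Definition has_deriv_nneg (R : realType) (p q : nat) (f : R -> 'M[R]_(p, q))
    (t : R) (d : 'M[R]_(p, q)) : Prop :=
  (s - t)^-1 *: (f s - f t) @[s --> within [set s : R | 0 <= s] t^'] --> d.

(** The values of [Z] at negative times are irrelevant. *)
Definition solves_ivp (R : realType) (n : nat) (L : 'M[R]_n -> 'M[R]_n)
    (X0 : 'M[R]_n) (Z : R -> 'M[R]_n) : Prop :=
  Z 0 = X0 /\ forall t : R, 0 <= t -> has_deriv_nneg Z t (L (Z t)).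

Definition int_to (R : realType) (p q : nat) (t : R) (f : R -> 'M[R]_(p, q)) :
    'M[R]_(p, q) :=
  \matrix_(i, j) Rintegral lebesgue_measure `[0, t] (fun s => f s i j).

Definition improper_cvg (R : realType) (p q : nat) (f : R -> 'M[R]_(p, q)) :
    Prop :=
  cvg (int_to t f @[t --> +oo]).

Definition int_infty (R : realType) (p q : nat) (f : R -> 'M[R]_(p, q)) :
    'M[R]_(p, q) :=
  lim (int_to t f @[t --> +oo]).

Definition cvg_series1 (R : realType) (p q : nat) (u : nat -> 'M[R]_(p, q)) :
    Prop :=
  cvgn (fun r : nat => \sum_(1 <= i < r) u i).

Definition sum_series1 (R : realType) (p q : nat) (u : nat -> 'M[R]_(p, q)) :
    'M[R]_(p, q) :=
  limn (fun r : nat => \sum_(1 <= i < r) u i).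

(** [J] is the integral used in the initial values: [int_to T] for Z_{i,T} and
    [int_infty] for Z_{i,oo}. The family is indexed from 1; [Z 0%N] is unused. *)
Definition Z_family (R : realType) (n m : nat) (A : 'M[R]_n) (B : 'M[R]_(n, m))
    (N : 'I_m -> 'M[R]_n) (H : 'I_n -> 'M[R]_n)
    (J : (R -> 'M[R]_n) -> 'M[R]_n) (Z : nat -> R -> 'M[R]_n) : Prop :=
  solves_ivp (lyap A N) (B *m B^T) (Z 1%N) /\
  forall i : nat, (2 <= i)%N ->
    solves_ivp (lyap A N)
      (block_row H *m (\sum_(1 <= k < i) J (Z k) *t J (Z (i - k)%N))
         *m (block_row H)^T)
      (Z i).

Definition gramian (R : realType) (n : nat) (J : (R -> 'M[R]_n) -> 'M[R]_n)
    (Z : nat -> R -> 'M[R]_n) : 'M[R]_n :=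
  sum_series1 (fun i => J (Z i)).

Definition gramian_T_exists (R : realType) (n : nat) (T : R)
    (Z : nat -> R -> 'M[R]_n) : Prop :=
  cvg_series1 (fun i => int_to T (Z i)).

Definition gramian_infty_exists (R : realType) (n : nat)
    (Z : nat -> R -> 'M[R]_n) : Prop :=
  (forall i : nat, (1 <= i)%N -> improper_cvg (Z i)) /\
  cvg_series1 (fun i => int_infty (Z i)).

(* Main.v *)
Require Import Defs.
From HB Require Import structures.
From mathcomp Require Import all_boot all_order all_algebra.
From mathcomp Require Import all_classical all_reals all_analysis.
From mathcomp Require Import complex mxtens.
From mathcomp Require Import ring lra zify.
Import Order.TTheory GRing.Theory Num.Theory.
Import numFieldNormedType.Exports.

(** Integrating the equation of [Z_i] gives, for [X_i] the integral of [Z_i],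
    [E_i = Z_i(0) + lyap A N X_i], where [E_i = Z_i(T)] for the integral over
    [[0, T]] and [E_i = 0] for the improper one. Summing over [i], the terms
    [lyap A N X_i] add up to [lyap A N P], and the initial values add up to
    [B *m B^T] plus the image of the Cauchy product of [sum X_i] with itself
    under [kron_congr H]. Both claims follow once this Cauchy product is known
    to converge to [P *t P], and this is the delicate point: it can fail for
    conditionally convergent series.

    Absolute convergence comes from positivity. All [Z_i(t)], hence all [X_i],
    are symmetric positive semidefinite, and the entries of such a matrix are
    bounded by its trace; so each entry series is dominated by the convergent
    series of the traces of the [X_i] ([cvg_tens_cauchy_product]).

    Positivity is proved by induction on [i]: the initial value is a sum of
    congruences of Kronecker products of positive semidefinite matrices
    ([psd_tens]), and the flow of [lyap A N] preserves the cone ([psd_flow]).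
    For the latter, the explicit Euler step differs by [O(h^2)] from
    [(1 + h A) X (1 + h A)^T + h * sum_k N_k X N_k^T], which maps the cone into
    itself and expands distances by a factor at most [1 + C h]. The distance of
    [Z(t)] to the cone thus satisfies the differential inequality
    [phi' <= C phi], and it vanishes at [0]; a Gronwall argument
    ([dini_nonpos]) shows that it vanishes identically.

    For the improper integral, [E_i = 0] because [Z_i(t)] is the initial value
    plus the image under [lyap A N] of a convergent integral: it converges, and
    a function with a limit and a convergent integral has limit [0]
    ([cvg_integral_lim0]). *)

Set Implicit Arguments.
Unset Strict Implicit.
Unset Printing Implicit Defensive.

Local Open Scope classical_set_scope.
Local Open Scope ring_scope.

(** * Positive semidefinite matrices *)

Definition psd (R : realType) (n : nat) (X : 'M[R]_n) : Prop :=
  X^T = X /\ forall v : 'rV_n, 0 <= (v *m X *m v^T) 0 0.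

Lemma psd0 (R : realType) (n : nat) : psd (0 : 'M[R]_n).
Proof. by split=> [|v]; rewrite ?trmx0// mulmx0 mul0mx mxE. Qed.

Lemma psdD (R : realType) (n : nat) (X Y : 'M[R]_n) :
  psd X -> psd Y -> psd (X + Y).
Proof.
move=> [sX pX] [sY pY]; split=> [|v]; first by rewrite linearD /= sX sY.
by rewrite mulmxDr mulmxDl mxE addr_ge0.
Qed.

Lemma psdZ (R : realType) (n : nat) (c : R) (X : 'M[R]_n) :
  0 <= c -> psd X -> psd (c *: X).
Proof.
move=> c0 [sX pX]; split=> [|v]; first by rewrite linearZ /= sX.
by rewrite -scalemxAr -scalemxAl mxE mulr_ge0.
Qed.

Lemma psd_sum (R : realType) (n : nat) (I : Type) (r : seq I) (P : pred I)
    (F : I -> 'M[R]_n) :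
  (forall i, P i -> psd (F i)) -> psd (\sum_(i <- r | P i) F i).
Proof. by move=> pF; apply: big_ind => //; [exact: psd0|exact: psdD]. Qed.

Lemma psd_congr (R : realType) (n p : nat) (M : 'M[R]_(p, n)) (X : 'M[R]_n) :
  psd X -> psd (M *m X *m M^T).
Proof.
move=> [sX pX]; split=> [|v]; first by rewrite !trmx_mul trmxK sX mulmxA.
by rewrite !mulmxA -mulmxA -trmx_mul.
Qed.

Lemma psd_gram (R : realType) (n p : nat) (G : 'M[R]_(n, p)) :
  psd (G *m G^T).
Proof.
rewrite -[G in G *m _]mulmx1; apply: psd_congr.
split=> [|v]; first exact: trmx1.
rewrite mulmx1 mxE sumr_ge0// => i _.
by rewrite mxE -expr2 sqr_ge0.
Qed.

Lemma quad_delta (R : realType) (n : nat) (X : 'M[R]_n) (i j : 'I_n) :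
  ((delta_mx 0 i : 'rV_n) *m X *m (delta_mx 0 j : 'rV_n)^T) 0 0 = X i j.
Proof. by rewrite trmx_delta -rowE -colE !mxE. Qed.

Lemma entryD (R : pzRingType) (p q : nat) (X Y : 'M[R]_(p, q)) i j :
  (X + Y) i j = X i j + Y i j.
Proof. exact: mxE. Qed.

Lemma entryN (R : pzRingType) (p q : nat) (X : 'M[R]_(p, q)) i j :
  (- X) i j = - X i j.
Proof. exact: mxE. Qed.

Lemma entryZ (R : pzRingType) (p q : nat) (c : R) (X : 'M[R]_(p, q)) i j :
  (c *: X) i j = c * X i j.
Proof. exact: mxE. Qed.

(** The quadratic form of [X] at [x e_i + e_j]. *)
Lemma psd_two (R : realType) (n : nat) (X : 'M[R]_n) (x : R) (i j : 'I_n) :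
  psd X -> 0 <= x ^+ 2 * X i i + x * X i j *+ 2 + X j j.
Proof.
move=> [sX pX].
have -> : X i i = ((delta_mx 0 i : 'rV_n) *m X *m (delta_mx 0 i : 'rV_n)^T) 0 0.
  by rewrite quad_delta.
apply: le_trans (pX (x *: delta_mx 0 i + delta_mx 0 j)) _.
rewrite linearD linearZ /= !(mulmxDl, mulmxDr) -!scalemxAl -!scalemxAr.
rewrite !entryD !entryZ !quad_delta.
have -> : X j i = X i j by rewrite -[in LHS]sX mxE.
by rewrite le_eqVlt; apply/orP; left; apply/eqP; ring.
Qed.

Lemma psd_diag_ge0 (R : realType) (n : nat) (X : 'M[R]_n) (i : 'I_n) :
  psd X -> 0 <= X i i.
Proof. by move=> [_ pX]; rewrite -quad_delta. Qed.

(** By [psd_two] at [x = 1] and [x = -1], the modulus of an entry is at most the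
    mean of the diagonal entries in its row and its column. This is what turns
    convergence of a series of positive semidefinite matrices into absolute
    convergence. *)
Lemma psd_le_trace (R : realType) (n : nat) (X : 'M[R]_n) (i j : 'I_n) :
  psd X -> `|X i j| <= \tr X.
Proof.
move=> pX.
have le_tr k : X k k <= \tr X.
  by rewrite /mxtrace (bigD1 k)//= lerDl sumr_ge0// => l _; exact: psd_diag_ge0.
have := psd_two 1 i j pX; have := psd_two (-1) i j pX.
have := le_tr i; have := le_tr j.
by rewrite ler_norml => *; apply/andP; split; lra.
Qed.

(** Otherwise [psd_two] would make a nonconstant affine function of [x]
    nonnegative. *)
Lemma psd_row0 (R : realType) (n : nat) (X : 'M[R]_n) (i : 'I_n) :
  psd X -> X i i = 0 -> forall j, X i j = 0.
Proof.
move=> pX Xii j; apply/eqP/contraT => Xij.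
(* At this point the form takes the value [-1]. *)
have := psd_two (- (X j j + 1) / (X i j *+ 2)) i j pX.
rewrite Xii mulr0 add0r -mulrnAr divfK; last by rewrite mulrn_eq0.
by rewrite opprD addrAC addNr add0r oppr_ge0 ler10.
Qed.

(** One step of a symmetric Gaussian elimination. The quadratic form of the
    difference at [v] is that of [X] at [v - c e_i], where [c] minimises it. If
    [X i i = 0] the inverse is [0] and nothing is subtracted, in accordance with
    [psd_row0]. *)
Lemma psd_peel (R : realType) (n : nat) (X : 'M[R]_n) (i : 'I_n) :
  psd X -> psd (X - (X i i)^-1 *: (col i X *m (col i X)^T)).
Proof.
move=> pX; have [sX qX] := pX.
have [Xii|Xii] := eqVneq (X i i) 0.
  by rewrite Xii invr0 scale0r subr0.
split=> [|v]; first by rewrite linearB linearZ /= trmx_mul trmxK sX.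
pose e : 'rV[R]_n := delta_mx 0 i.
have eX : e *m X = (col i X)^T by rewrite tr_col sX -rowE.
have Xe : X *m e^T = col i X by rewrite trmx_delta -colE.
pose s := (v *m col i X) 0 0.
have E1 : (v *m X *m e^T) 0 0 = s by rewrite -mulmxA Xe.
have E2 : (e *m X *m v^T) 0 0 = s.
  by rewrite eX -trmx_mul mxE.
have E3 : (e *m X *m e^T) 0 0 = X i i by rewrite quad_delta.
have E4 : (v *m (col i X *m (col i X)^T) *m v^T) 0 0 = s * s.
  rewrite mulmxA -mulmxA -trmx_mul mxE big_ord1; congr (_ * _).
  by rewrite mxE.
pose c := (X i i)^-1 * s.
have vceT : (v - c *: e)^T = v^T - c *: e^T by rewrite linearB linearZ.
apply: le_trans (qX (v - c *: e)) _.
rewrite vceT !(mulmxBl, mulmxBr) -!(scalemxAl, scalemxAr).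
rewrite !(entryD, entryN, entryZ) E1 E2 E3 E4 /c.
rewrite le_eqVlt; apply/orP; left; apply/eqP; field.
exact: Xii.
Qed.

(** Peeling off the rows one after the other, from the last to the first, writes
    [X] as a sum of rank-one squares. *)
Lemma psd_factor (R : realType) (n : nat) (X : 'M[R]_n) :
  psd X -> exists p (G : 'M[R]_(n, p)), X = G *m G^T.
Proof.
move=> pX.
suff peel k : (k <= n)%N -> forall Y : 'M[R]_n, psd Y ->
    (forall i j : 'I_n, (k <= i)%N -> Y i j = 0) ->
    exists p (G : 'M[R]_(n, p)), Y = G *m G^T.
  by apply: (peel n (leqnn n)) => // i j; rewrite leqNgt ltn_ord.
elim: k => [_ Y _ Y0|k IH kn Y pY Y0].
  exists 0%N, 0; rewrite mul0mx; apply/matrixP => i j.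
  by rewrite Y0// mxE.
pose i := Ordinal kn; pose a := Y i i.
have [l j kl|p [G YG]] := IH (ltnW kn) _ (psd_peel i pY).
- have Y0l : (k < l)%N -> Y l j = 0 by exact: Y0.
  have colE' : (col i Y *m (col i Y)^T) l j = Y l i * Y i j.
    by case: pY => sY _; rewrite tr_col sY mxE big_ord1 !mxE.
  rewrite entryD entryN entryZ colE'.
  have [kl'|lk|lk] := ltngtP k l.
  + by rewrite (Y0 _ _ kl') (Y0 _ _ kl') mul0r mulr0 subrr.
  + by move: (leq_trans lk kl); rewrite ltnn.
  have -> : l = i by apply/val_inj.
  have [Yii|Yii] := eqVneq (Y i i) 0.
    by rewrite (psd_row0 pY Yii j) mulr0 mulr0 subr0.
  by rewrite mulKf// subrr.
pose b := Num.sqrt (Y i i)^-1.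
exists (p + 1)%N, (row_mx G (b *: col i Y)).
rewrite tr_row_mx mul_row_col -YG [(b *: _)^T]linearZ -scalemxAl -scalemxAr scalerA.
by rewrite -expr2 sqr_sqrtr ?subrK// invr_ge0 psd_diag_ge0.
Qed.

(** With [X = G *m G^T] and [Y = F *m F^T], the Kronecker product is the Gram
    matrix of [G *t F]. *)
Lemma psd_tens (R : realType) (n p : nat) (X : 'M[R]_n) (Y : 'M[R]_p) :
  psd X -> psd Y -> psd (X *t Y).
Proof.
move=> /psd_factor[k [G ->]] /psd_factor[l [F ->]].
by rewrite -tensmx_mul -trmx_tens; exact: psd_gram.
Qed.

(** * Entrywise convergence and linear maps of matrices *)

Lemma le_entry_norm (R : realType) (p q : nat) (X : 'M[R]_(p, q)) i j :
  `|X i j| <= `|X|.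
Proof.
rewrite [leRHS]/Num.norm /= mx_normrE.
exact: (le_bigmax 0 (fun ij => `|X ij.1 ij.2|) (i, j)).
Qed.

Lemma norm_le_entries (R : realType) (p q : nat) (X : 'M[R]_(p, q)) (e : R) :
  0 <= e -> (forall i j, `|X i j| <= e) -> `|X| <= e.
Proof.
move=> e0 Xe; rewrite [leLHS]/Num.norm /= mx_normrE.
by apply: bigmax_le => // -[i j] _; exact: Xe.
Qed.

Lemma cvg_entries (R : realType) (p q : nat) (T : Type) (F : set_system T)
    {FF : Filter F} (f : T -> 'M[R]_(p, q)) (l : 'M[R]_(p, q)) :
  f x @[x --> F] --> l <-> forall i j, f x i j @[x --> F] --> l i j.
Proof.
split=> [fl i j|fl].
  have := @coord_continuous R p q i j l; exact: cvg_comp.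
apply/cvgrPdist_le => e e0.
have : \forall x \near F, forall ij : 'I_p * 'I_q, `|l ij.1 ij.2 - f x ij.1 ij.2| <= e.
  apply: filter_forall => -[i j] /=.
  by move/cvgrPdist_le : (fl i j); apply.
apply: filterS => x xe; apply: norm_le_entries => [|i j]; first exact: ltW.
by rewrite !mxE; exact: (xe (i, j)).
Qed.

Lemma linear_entries (R : realType) (p q k l : nat)
    (L : {linear 'M[R]_(p, q) -> 'M[R]_(k, l)}) (X : 'M[R]_(p, q)) :
  L X = \sum_i \sum_j X i j *: L (delta_mx i j).
Proof.
rewrite {1}[X]matrix_sum_delta linear_sum; apply: eq_bigr => i _.
by rewrite linear_sum; apply: eq_bigr => j _; rewrite linearZ.
Qed.

Lemma linear_bound (R : realType) (p q k l : nat)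
    (L : {linear 'M[R]_(p, q) -> 'M[R]_(k, l)}) :
  exists2 C : R, 0 <= C & forall X, `|L X| <= C * `|X|.
Proof.
exists (\sum_i \sum_j `|L (delta_mx i j)|) => [|X].
  by rewrite sumr_ge0// => i _; rewrite sumr_ge0.
rewrite linear_entries mulr_suml (le_trans (ler_norm_sum _ _ _))//.
apply: ler_sum => i _.
rewrite mulr_suml (le_trans (ler_norm_sum _ _ _))// ler_sum// => j _.
by rewrite normrZ mulrC ler_wpM2l// le_entry_norm.
Qed.

Lemma cvg_linear (R : realType) (p q k l : nat) (T : Type) (F : set_system T)
    {FF : Filter F} (L : {linear 'M[R]_(p, q) -> 'M[R]_(k, l)})
    (f : T -> 'M[R]_(p, q)) (X : 'M[R]_(p, q)) :
  f x @[x --> F] --> X -> L (f x) @[x --> F] --> L X.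
Proof.
move=> fX; have [C C0 LC] := linear_bound L.
apply/cvgrPdist_le => e e0.
have C1 : 0 < C + 1 by rewrite ltr_wpDl.
move/cvgrPdist_le : fX => /(_ (e / (C + 1)) (divr_gt0 e0 C1)).
apply: filterS => x; rewrite ler_pdivlMr// => xe.
rewrite -linearB (le_trans (LC _))// (le_trans _ xe)// mulrC ler_wpM2l//.
by rewrite lerDl.
Qed.

(** * A Gronwall lemma *)

(** A function satisfying [phi' <= C phi] in the sense of upper right Dini
    derivatives, and lower semicontinuous from the left, stays nonpositive. It
    cannot cross the barrier [g t = e * expR ((C + 1) * t)], which grows faster
    than the inequality allows: at the last time [tau] before which
    [phi <= g], the left condition gives [phi tau <= g tau], and the right one
    extends the bound beyond [tau]. Then [e] tends to [0]. *)
Lemma dini_nonpos (R : realType) (phi : R -> R) (C : R) :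
  0 <= C -> phi 0 <= 0 ->
  (forall t e : R, 0 <= t -> 0 < e -> exists2 d, 0 < d &
     forall h, 0 < h -> h < d -> phi (t + h) <= (1 + C * h) * phi t + e * h) ->
  (forall t e : R, 0 < t -> 0 < e -> exists2 d, 0 < d &
     forall s, 0 <= s -> s <= t -> t - s < d -> phi t <= phi s + e) ->
  forall t, 0 <= t -> phi t <= 0.
Proof.
move=> C0 phi0 step left T T0.
suff bnd e : 0 < e -> phi T <= e * expR ((C + 1) * T).
  apply/ler_addgt0Pr => e e0; rewrite add0r.
  have ex0 := expR_gt0 ((C + 1) * T).
  by have := bnd _ (divr_gt0 e0 ex0); rewrite divfK// gt_eqF.
move=> e0; pose g t := e * expR ((C + 1) * t).
have g0 t : 0 < g t by rewrite mulr_gt0// expR_gt0.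
have g_incr s t : s <= t -> g s <= g t.
  move=> st; rewrite ler_wpM2l ?(ltW e0)// ler_expR ler_wpM2l// addr_ge0//.
pose E := [set t | 0 <= t <= T /\ forall s, 0 <= s <= t -> phi s <= g s].
have E0 : E 0.
  split=> [|s s0]; first by rewrite lexx.
  have -> : s = 0 by apply/eqP; rewrite eq_le andbC.
  by rewrite (le_trans phi0)// ltW.
have supE : has_sup E.
  by split; [exists 0|exists T => t [/andP[]]].
pose tau := sup E.
have ubE t : E t -> t <= tau.
  by move=> Et; apply: ub_le_sup => //; case: supE.
have tau0 : 0 <= tau by exact: ubE.
have tauT : tau <= T.
  by apply: ge_sup; [exists 0|move=> t [/andP[]]].
have below s : 0 <= s -> s < tau -> phi s <= g s.
  move=> s0 st; have ts0 : 0 < tau - s by rewrite subr_gt0.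
  have [t [_ Et]] := sup_adherent ts0 supE.
  rewrite -/tau subKr => st'; apply: Et; rewrite s0 ltW//.
have at_tau : phi tau <= g tau.
  have [->|tau_neq0] := eqVneq tau 0; first by rewrite (le_trans phi0)// ltW.
  have tau_gt0 : 0 < tau by rewrite lt_neqAle eq_sym tau_neq0.
  apply/ler_addgt0Pr => a a0.
  have [d d0 phid] := left tau a tau_gt0 a0.
  pose s := Num.max 0 (tau - d / 2).
  have s0 : 0 <= s by rewrite le_max lexx.
  have st : s < tau by rewrite gt_max tau_gt0/= ltrBlDr ltrDl divr_gt0.
  have sd : tau - s < d.
    have : tau - d / 2 <= s by rewrite le_max lexx orbT.
    move: d0; lra.
  rewrite (le_trans (phid s s0 (ltW st) sd))// lerD2r.
  by rewrite (le_trans (below s s0 st))// g_incr// ltW.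
have [<-//|tau_neqT] := eqVneq tau T.
have tau_ltT : tau < T by rewrite lt_neqAle tau_neqT.
have [d d0 phid] := step tau (g tau) tau0 (g0 tau).
pose u := Num.min T (tau + d / 2).
have tau_u : tau < u by rewrite lt_min tau_ltT/= ltrDl divr_gt0.
have u_d : u - tau < d.
  have : u <= tau + d / 2 by rewrite ge_min lexx orbT.
  move: d0; lra.
suff /ubE : E u by rewrite leNgt tau_u.
split=> [|s /andP[s0 su]].
  by rewrite (le_trans tau0 (ltW tau_u))/= ge_min lexx.
have [st|ts|->//] := ltgtP s tau; first exact: below.
have h0 : 0 < s - tau by rewrite subr_gt0.
have hd : s - tau < d by rewrite (le_lt_trans _ u_d)// lerD2r.
have := phid _ h0 hd; rewrite addrC subrK => /le_trans; apply.
have -> : g s = expR ((C + 1) * (s - tau)) * g tau.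
  rewrite /g mulrCA -expRD; congr (_ * expR _); ring.
apply: (@le_trans _ _ ((1 + C * (s - tau)) * g tau + g tau * (s - tau))).
  by rewrite lerD2r ler_wpM2l// addr_ge0// mulr_ge0// ltW.
rewrite (mulrC (g tau)) -mulrDl ler_wpM2r ?(ltW (g0 tau))//.
rewrite (le_trans _ (expR_ge1Dx _))// le_eqVlt; apply/orP; left; apply/eqP; ring.
Qed.

(** * Invariance of the cone under the flow *)

Lemma psd_approx (R : realType) (n : nat) (X : 'M[R]_n) :
  (forall e, 0 < e -> exists2 S, psd S & `|X - S| <= e) -> psd X.
Proof.
move=> Xe; split=> [|v].
  apply/matrixP => i j; apply/eqP; rewrite -subr_eq0 -normr_le0.
  apply/ler_addgt0Pr => e e0; rewrite add0r.
  have [S [sS _] XS] := Xe (e / 2) (divr_gt0 e0 (ltr0n _ 2)).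
  have bnd a b : `|X a b - S a b| <= e / 2.
    by apply: le_trans XS; have := le_entry_norm (X - S) a b; rewrite !mxE.
  have Sij : S i j = S j i by rewrite -[in LHS]sS mxE.
  have := bnd i j; have := bnd j i.
  rewrite mxE Sij !ler_norml => /andP[? ?] /andP[? ?].
  apply/andP; split; lra.
pose L : {linear 'M[R]_n -> 'M[R]_1} := mulmxr v^T \o mulmx v.
have [C C0 LC] := linear_bound L.
apply/ler_addgt0Pr => e e0.
have C1 : 0 < C + 1 by rewrite ltr_wpDl.
have [S [_ qS] XS] := Xe (e / (C + 1)) (divr_gt0 e0 C1).
have : `|(L X) 0 0 - (L S) 0 0| <= e.
  have -> : L X 0 0 - L S 0 0 = (L (X - S)) 0 0 by rewrite linearB !mxE.
  rewrite (le_trans (le_entry_norm _ _ _))// (le_trans (LC _))//.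
  move: XS; rewrite ler_pdivlMr//; apply: le_trans.
  by rewrite mulrC ler_wpM2l// lerDl.
have := qS v; rewrite /L /= ler_norml => ? /andP[? ?]; lra.
Qed.

Lemma psd_cvg (R : realType) (n : nat) (T : Type) (F : set_system T)
    {FF : ProperFilter F} (f : T -> 'M[R]_n) (X : 'M[R]_n) :
  (\forall x \near F, psd (f x)) -> f x @[x --> F] --> X -> psd X.
Proof.
move=> pf fX; apply: psd_approx => e e0.
have Fe : \forall x \near F, psd (f x) /\ `|X - f x| <= e.
  by near=> x; split; near: x => //; move/cvgrPdist_le : fX; apply.
by have [x [px xe]] := filter_ex Fe; exists (f x).
Unshelve. all: by end_near. Qed.

Definition psd_dist (R : realType) (n : nat) (X : 'M[R]_n) : R :=
  inf [set `|X - S| | S in [set S | psd S]].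

Lemma psd_dist_le (R : realType) (n : nat) (X S : 'M[R]_n) :
  psd S -> psd_dist X <= `|X - S|.
Proof.
move=> pS; apply: ge_inf; last by exists S.
by exists 0 => _ [Y _ <-].
Qed.

(** An affine bound in terms of the distances to all points of the cone passes
    to their infimum, which need not be known to be attained. *)
Lemma le_psd_dist (R : realType) (n : nat) (X : 'M[R]_n) (a b c : R) :
  0 < c -> (forall S, psd S -> a <= c * `|X - S| + b) ->
  a <= c * psd_dist X + b.
Proof.
move=> c0 aS; rewrite -lerBlDr mulrC -ler_pdivrMr//.
apply: lb_le_inf; first by exists `|X - 0|, 0 => //; exact: psd0.
by move=> _ [S pS <-]; rewrite ler_pdivrMr// mulrC lerBlDr aS.
Qed.

Lemma psd_dist_eq0 (R : realType) (n : nat) (X : 'M[R]_n) :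
  psd_dist X <= 0 -> psd X.
Proof.
move=> X0; apply: psd_approx => e e0.
have : has_inf [set `|X - S| | S in [set S | psd S]].
  split; first by exists `|X - 0|, 0 => //; exact: psd0.
  by exists 0 => _ [Y _ <-].
move=> /(inf_adherent e0)[_ [S pS <-]] XS; exists S => //.
by rewrite (le_trans (ltW XS))// -[leRHS]add0r lerD2r.
Qed.

Lemma psd_dist_lip (R : realType) (n : nat) (X Y : 'M[R]_n) :
  psd_dist X <= psd_dist Y + `|X - Y|.
Proof.
rewrite -[psd_dist Y]mul1r; apply: le_psd_dist => // S pS.
rewrite mul1r (le_trans (psd_dist_le _ pS))//.
have -> : X - S = (Y - S) + (X - Y) by rewrite [RHS]addrC addrA subrK.
exact: ler_normD.
Qed.

Lemma has_deriv_nneg_approx (R : realType) (p q : nat) (f : R -> 'M[R]_(p, q))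
    (t : R) (D : 'M[R]_(p, q)) :
  has_deriv_nneg f t D ->
  forall e : R, 0 < e -> exists2 d : R, 0 < d & forall s, 0 <= s ->
    `|s - t| < d -> `|f s - f t - (s - t) *: D| <= e * `|s - t|.
Proof.
move=> fD e e0; move/cvgrPdist_le : fD => /(_ e e0).
rewrite near_withinE near_withinE => /nbhs_ballP[d /= d0 td].
exists d => // s s0 st.
have [->|neq] := eqVneq s t.
  by rewrite !subrr scale0r subrr !normr0 mulr0.
have st0 : s - t != 0 by rewrite subr_eq0.
have /(_ _ neq s0) := td s; rewrite /ball /= distrC => /(_ st) De.
have -> : f s - f t - (s - t) *: D =
    - ((s - t) *: (D - (s - t)^-1 *: (f s - f t))).
  by rewrite scalerBr scalerA divff// scale1r opprB.
by rewrite normrN normrZ mulrC ler_wpM2r.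
Qed.

Lemma lyap_is_linear (R : comPzRingType) (n m : nat) (A : 'M[R]_n)
    (N : 'I_m -> 'M[R]_n) : linear (lyap A N).
Proof.
move=> c X Y; rewrite !lyapE !(mulmxDl, mulmxDr) -!scalemxAl -!scalemxAr.
rewrite !scalerDr scaler_sumr !addrA.
have -> : \sum_k N k *m (c *: X + Y) *m (N k)^T =
    \sum_k c *: (N k *m X *m (N k)^T) + \sum_k N k *m Y *m (N k)^T.
  rewrite -big_split; apply: eq_bigr => k _ /=.
  by rewrite mulmxDr mulmxDl -scalemxAr -scalemxAl.
by apply/matrixP => i j; rewrite !entryD; ring.
Qed.

HB.instance Definition _ (R : comPzRingType) (n m : nat) (A : 'M[R]_n)
    (N : 'I_m -> 'M[R]_n) :=
  GRing.isLinear.Build R 'M[R]_n 'M[R]_n _ (lyap A N) (lyap_is_linear A N).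

(** An Euler step of the flow of [lyap A N], corrected by the second-order term
    that completes it to the positive map of [euler_stepE]. *)
Definition euler_step (R : comPzRingType) (n m : nat) (A : 'M[R]_n)
    (N : 'I_m -> 'M[R]_n) (h : R) (X : 'M[R]_n) : 'M[R]_n :=
  X + h *: lyap A N X + h ^+ 2 *: (A *m X *m A^T).

Lemma euler_stepE (R : comPzRingType) (n m : nat) (A : 'M[R]_n)
    (N : 'I_m -> 'M[R]_n) (h : R) (X : 'M[R]_n) :
  euler_step A N h X = (1%:M + h *: A) *m X *m (1%:M + h *: A)^T
    + h *: \sum_k N k *m X *m (N k)^T.
Proof.
have -> : (1%:M + h *: A)^T = 1%:M + h *: A^T by rewrite linearD linearZ /= trmx1.
rewrite /euler_step lyapE !(mulmxDl, mulmxDr) !mul1mx !mulmx1.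
rewrite -!(scalemxAl, scalemxAr) scalerA -expr2 !scalerDr.
by apply/matrixP => i j; rewrite !entryD; ring.
Qed.

Lemma psd_euler_step (R : realType) (n m : nat) (A : 'M[R]_n)
    (N : 'I_m -> 'M[R]_n) (h : R) (X : 'M[R]_n) :
  0 <= h -> psd X -> psd (euler_step A N h X).
Proof.
move=> h0 pX; rewrite euler_stepE; apply: psdD; first exact: psd_congr.
by apply: psdZ => //; apply: psd_sum => k _; exact: psd_congr.
Qed.

(** The distance of [Z t] to the cone satisfies the hypotheses of [dini_nonpos]:
    the corrected Euler step keeps the cone invariant, expands distances by at
    most [1 + (C1 + C2) h] for [h <= 1], and misses [Z (t + h)] by [o(h)]. *)
Lemma psd_flow (R : realType) (n m : nat) (A : 'M[R]_n)
    (N : 'I_m -> 'M[R]_n) (Z0 : 'M[R]_n) (Z : R -> 'M[R]_n) :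
  solves_ivp (lyap A N) Z0 Z -> psd Z0 -> forall t, 0 <= t -> psd (Z t).
Proof.
move=> [<- dZ] pZ0 t t0; apply: psd_dist_eq0.
have [C1 C10 bndL] := linear_bound (lyap A N).
pose Q : {linear 'M[R]_n -> 'M[R]_n} := mulmxr A^T \o mulmx A.
have [C2 C20 bndQ] := linear_bound Q.
apply: (@dini_nonpos R (fun t => psd_dist (Z t)) (C1 + C2)) t t0 => //.
- exact: addr_ge0.
- by have := psd_dist_le (Z 0) pZ0; rewrite subrr normr0.
- move=> t e t0 e0.
  have e20 : 0 < e / 2 by exact: divr_gt0.
  have [d d0 Zd] := has_deriv_nneg_approx (dZ t t0) e20.
  (* [h < e / 2 / K] makes the second-order term at most [e / 2 * h]. *)
  pose K := `|Q (Z t)| + 1.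
  have K0 : 0 < K by rewrite ltr_wpDl.
  exists (Num.min d (Num.min 1 (e / 2 / K))).
    by rewrite !lt_min d0 ltr01 divr_gt0.
  move=> h h0; rewrite !lt_min => /and3P[hd h1 hK].
  apply: le_psd_dist => [|S pS].
    by rewrite ltr_wpDr// mulr_ge0 ?addr_ge0// ltW.
  apply: le_trans (psd_dist_le _ (psd_euler_step A N (ltW h0) pS)) _.
  have th0 : 0 <= t + h by rewrite addr_ge0// ltW.
  have := Zd _ th0; rewrite addrAC subrr add0r (gtr0_norm h0) => /(_ hd) Zh.
  pose D := Z t - S.
  have -> : Z (t + h) - euler_step A N h S =
      (Z (t + h) - Z t - h *: lyap A N (Z t))
      + (D + h *: lyap A N D + h ^+ 2 *: Q D - h ^+ 2 *: Q (Z t)).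
    rewrite /euler_step [lyap A N D]linearB [Q D]linearB /Q /=.
    by apply/matrixP => i j; rewrite !(entryD, entryN, entryZ); ring.
  have hh : h ^+ 2 * `|Q (Z t)| <= e / 2 * h.
    rewrite expr2 -mulrA [leRHS]mulrC ler_wpM2l ?(ltW h0)//.
    move: hK; rewrite ltr_pdivlMr// => /ltW; apply: le_trans.
    by rewrite ler_wpM2l ?(ltW h0)// lerDl.
  have hL : h * `|lyap A N D| <= h * (C1 * `|D|) by rewrite ler_wpM2l ?(ltW h0) ?bndL.
  have hQ : h ^+ 2 * `|Q D| <= h * (C2 * `|D|).
    rewrite expr2 -mulrA ler_wpM2l ?(ltW h0)// (le_trans _ (bndQ _))//.
    by rewrite ler_piMl// ltW.
  have h20 : 0 <= h ^+ 2 by rewrite sqr_ge0.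
  apply: le_trans (ler_normD _ _) _.
  apply: (@le_trans _ _ (e / 2 * h
    + (`|D| + h * (C1 * `|D|) + h * (C2 * `|D|) + e / 2 * h))).
    apply: lerD => //.
    apply: le_trans (ler_normB _ _) _; apply: lerD; last first.
      by rewrite normrZ ger0_norm.
    apply: le_trans (ler_normD _ _) _; apply: lerD; last first.
      by rewrite normrZ ger0_norm.
    apply: le_trans (ler_normD _ _) _; apply: lerD => //.
    by rewrite normrZ gtr0_norm.
  by rewrite le_eqVlt; apply/orP; left; apply/eqP; field.
- move=> t e t0 e0.
  have [d d0 Zd] := has_deriv_nneg_approx (dZ t (ltW t0)) ltr01.
  pose K := 1 + `|lyap A N (Z t)|.
  have K0 : 0 < K by rewrite ltr_wpDr.
  exists (Num.min d (e / K)); first by rewrite lt_min d0 divr_gt0.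
  move=> s s0 st; rewrite lt_min => /andP[sd sK].
  rewrite (le_trans (psd_dist_lip (Z t) (Z s)))// lerD2l distrC.
  have tsE : `|s - t| = t - s by rewrite distrC ger0_norm// subr_ge0.
  have := Zd s s0; rewrite tsE mul1r => /(_ sd) ZD.
  rewrite -[Z s - Z t](subrK ((s - t) *: lyap A N (Z t))).
  rewrite (le_trans (ler_normD _ _))// normrZ tsE.
  move: sK; rewrite ltr_pdivlMr// => /ltW; apply: le_trans.
  by rewrite /K mulrDr mulr1 lerD2r.
Qed.

(** * Integrating the equation *)

Lemma has_deriv_nneg_continuous (R : realType) (p q : nat)
    (f D : R -> 'M[R]_(p, q)) :
  (forall t, 0 <= t -> has_deriv_nneg f t (D t)) ->
  {within [set t : R | 0 <= t], continuous f}.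
Proof.
move=> fD; apply/subspace_continuousP => t /= t0.
have [d d0 fd] := has_deriv_nneg_approx (fD t t0) ltr01.
apply/cvgrPdist_le => e e0.
pose K := 1 + `|D t|.
have K0 : 0 < K by rewrite ltr_wpDr.
rewrite near_withinE; apply/nbhs_ballP.
exists (Num.min d (e / K)) => /=; first by rewrite lt_min d0 divr_gt0.
move=> s; rewrite /ball /= distrC lt_min => /andP[sd sK] s0.
have := fd s s0 sd; rewrite mul1r => fs.
rewrite distrC -[f s - f t](subrK ((s - t) *: D t)).
rewrite (le_trans (ler_normD _ _))// normrZ.
move: sK; rewrite ltr_pdivlMr// => /ltW; apply: le_trans.
by rewrite /K mulrDr mulr1 lerD2r.
Qed.

Lemma entry_continuous (R : realType) (p q : nat) (A : set R)
    (f : R -> 'M[R]_(p, q)) i j :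
  {within A, continuous f} -> {within A, continuous (fun s => f s i j)}.
Proof.
move=> /subspace_continuousP cf; apply/subspace_continuousP => x Ax.
by have /cvg_entries := cf x Ax; exact.
Qed.

Lemma linear_continuous_within (R : realType) (p q k l : nat) (A : set R)
    (L : {linear 'M[R]_(p, q) -> 'M[R]_(k, l)}) (f : R -> 'M[R]_(p, q)) :
  {within A, continuous f} -> {within A, continuous (fun s => L (f s))}.
Proof.
move=> /subspace_continuousP cf; apply/subspace_continuousP => x Ax.
by apply: cvg_linear; exact: cf.
Qed.

Lemma continuous_nneg_integrable (R : realType) (f : R -> R) (a b : R) :
  0 <= a -> {within [set t : R | 0 <= t], continuous f} ->
  (@lebesgue_measure R).-integrable `[a, b] (EFin \o f).
Proof.
move=> a0 cf; apply: continuous_compact_integrable.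
  exact: segment_compact.
apply: continuous_subspaceW cf => t /=; rewrite in_itv /= => /andP[at_ _].
exact: le_trans at_.
Qed.

Lemma integrable_EFin_sum (R : realType) (d : measure_display) (T : measurableType d)
    (mu : {measure set T -> \bar R}) (I : Type) (r : seq I) (D : set T)
    (f : I -> T -> R) :
  measurable D ->
  (forall i, mu.-integrable D (EFin \o f i)) ->
  mu.-integrable D (EFin \o (fun s => \sum_(i <- r) f i s)).
Proof.
move=> mD intf.
have := integrable_sum mD r (P := xpredT) (h := fun i => EFin \o f i)
  (fun i _ => intf i).
by apply: eq_integrable => // x _ /=; rewrite sumEFin.
Qed.

Lemma Rintegral_sum (R : realType) (d : measure_display) (T : measurableType d)
    (mu : {measure set T -> \bar R}) (I : Type) (r : seq I) (D : set T)
    (f : I -> T -> R) :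
  measurable D ->
  (forall i, mu.-integrable D (EFin \o f i)) ->
  Rintegral mu D (fun s => \sum_(i <- r) f i s)
  = \sum_(i <- r) Rintegral mu D (f i).
Proof.
move=> mD intf; elim: r => [|i r IH].
  rewrite big_nil; under eq_Rintegral do rewrite big_nil.
  by rewrite Rintegral_cst// mul0r.
rewrite big_cons -IH; under eq_Rintegral do rewrite big_cons.
by rewrite RintegralD//; exact: integrable_EFin_sum.
Qed.

Lemma int_to_linear (R : realType) (p q k l : nat)
    (L : {linear 'M[R]_(p, q) -> 'M[R]_(k, l)}) (f : R -> 'M[R]_(p, q)) (t : R) :
  {within [set t : R | 0 <= t], continuous f} ->
  int_to t (fun s => L (f s)) = L (int_to t f).
Proof.
move=> cf; rewrite linear_entries; apply/matrixP => a b; rewrite mxE.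
rewrite summxE.
under eq_Rintegral do rewrite linear_entries summxE.
have cfij i j :=
  continuous_nneg_integrable t (lexx 0) (entry_continuous (i := i) (j := j) cf).
have int_term i j : (@lebesgue_measure R).-integrable `[0, t]
    (EFin \o (fun s => (f s i j *: L (delta_mx i j)) a b)).
  have := integrableZl (mu := @lebesgue_measure R) (measurable_itv `[0, t])
    (L (delta_mx i j) a b) (cfij i j).
  apply: eq_integrable => // s _ /=.
  by rewrite mxE mulrC.
rewrite Rintegral_sum//; last first.
  move=> i.
  have := integrable_EFin_sum (index_enum 'I_q) _ (int_term i).
  move=> /(_ (measurable_itv _)); apply: eq_integrable => // s _ /=.
  by rewrite summxE.
apply: eq_bigr => i _; rewrite summxE.
under eq_Rintegral do rewrite summxE.
rewrite Rintegral_sum//; apply: eq_bigr => j _.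
rewrite !mxE -RintegralZr//.
by apply: eq_Rintegral => s _; rewrite mxE.
Qed.

Lemma psd_int_to (R : realType) (n : nat) (Z : R -> 'M[R]_n) (t : R) :
  {within [set t : R | 0 <= t], continuous Z} ->
  (forall s, 0 <= s -> psd (Z s)) -> psd (int_to t Z).
Proof.
move=> cZ pZ; have le0 (s : R) : `[0, t]%classic s -> 0 <= s.
  by rewrite /= in_itv /= => /andP[].
split=> [|v].
  apply/matrixP => i j; rewrite !mxE; apply: eq_Rintegral => s /set_mem /le0 s0.
  by have [sZ _] := pZ s s0; rewrite -[in LHS]sZ mxE.
pose L : {linear 'M[R]_n -> 'M[R]_1} := mulmxr v^T \o mulmx v.
have -> : v *m int_to t Z *m v^T = L (int_to t Z) by [].
rewrite -int_to_linear// mxE; apply: Rintegral_ge0 => s /le0 s0.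
by have [_] := pZ s s0; exact.
Qed.

(** The fundamental theorem of calculus, entry by entry; [L] is moved out of the
    integral by [int_to_linear]. *)
Lemma ivp_integral (R : realType) (n : nat) (L : {linear 'M[R]_n -> 'M[R]_n})
    (Z0 : 'M[R]_n) (Z : R -> 'M[R]_n) (t : R) :
  solves_ivp L Z0 Z -> 0 < t -> Z t = Z0 + L (int_to t Z).
Proof.
move=> [<- dZ] t0; have cZ := has_deriv_nneg_continuous dZ.
have cLZ := linear_continuous_within (L := L) cZ.
rewrite -int_to_linear//; apply/matrixP => i j; rewrite !mxE.
apply/eqP; rewrite addrC -subr_eq; apply/eqP.
have dZij (s : R) : 0 < s ->
    h^-1 *: (Z (h + s) i j - Z s i j) @[h --> 0^'] --> L (Z s) i j.
  move=> s0; apply/cvgrPdist_le => e e0.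
  have [d d0 Zd] := has_deriv_nneg_approx (dZ s (ltW s0)) e0.
  rewrite near_withinE; apply/nbhs_ballP.
  exists (Num.min d s) => /=; first by rewrite lt_min d0.
  move=> h; rewrite /ball /= sub0r normrN lt_min => /andP[hd hs] hneq.
  have hs0 : 0 <= h + s by move: hs; rewrite ltr_norml => /andP[? ?]; lra.
  have := Zd _ hs0; rewrite addrK => /(_ hd) Zh.
  have := le_trans (le_entry_norm _ i j) Zh.
  rewrite !mxE => Zij.
  rewrite -(ler_pM2r (x := `|h|)) ?normr_gt0// -normrM.
  rewrite (le_trans _ Zij)// -normrN le_eqVlt; apply/orP; left; apply/eqP.
  by congr `|_|; rewrite /GRing.scale /=; field.
apply/esym; rewrite /Rintegral.
have c0t : {within `[0, t], continuous (fun s => L (Z s) i j)}.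
  apply: continuous_subspaceW (entry_continuous cLZ) => s /=.
  by rewrite in_itv /= => /andP[].
rewrite (@continuous_FTC2 _ _ (fun s => Z s i j) _ _ t0 c0t) -?EFinB//.
- split.
  + move=> s; rewrite in_itv /= => /andP[s0 _].
    apply/cvg_ex; exists (L (Z s) i j).
    have := dZij s s0; apply: cvg_trans; apply: near_eq_cvg; near=> h.
    by rewrite /= [_%:A]mulr1.
  + have /subspace_continuousP/(_ 0 (lexx 0)) := entry_continuous (i := i) (j := j) cZ.
    apply: cvg_trans; apply: cvg_app; apply: within_subset => s /=.
    exact: ltW.
  + have /subspace_continuousP/(_ t (ltW t0)) := entry_continuous (i := i) (j := j) cZ.
    apply: cvg_trans; apply: cvg_app.
    move=> P nP; have {}nP : \forall s \near t, 0 <= s -> P s := nP.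
    change (\forall s \near t, s < t -> P s).
    by move: nP (lt_nbhsr t0); apply: filterS2 => s sP s0 _; exact: sP (ltW s0).
- move=> s; rewrite in_itv /= => /andP[s0 _].
  by rewrite /derive1; apply: cvg_lim => //; exact: dZij.
Unshelve. all: by end_near. Qed.

(** The mean of [g] over [[t, t + 1]] tends to [l], and is the difference of two
    values of a convergent function. *)
Lemma cvg_integral_lim0 (R : realType) (g : R -> R) (l G : R) :
  {within [set t : R | 0 <= t], continuous g} ->
  g t @[t --> +oo] --> l ->
  Rintegral lebesgue_measure `[0, t] g @[t --> +oo] --> G -> l = 0.
Proof.
move=> cg gl FG; apply/eqP; rewrite -normr_le0; apply/ler_addgt0Pr => e e0.
rewrite add0r; have e30 : 0 < e / 3 by exact: divr_gt0.
move/cvgrPdist_le : gl => /(_ _ e30)[M1 [_ gM]].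
move/cvgrPdist_le : FG => /(_ _ e30)[M2 [_ FM]].
pose t := Num.max 0 (Num.max M1 M2) + 1.
have t0 : 0 <= t by rewrite addr_ge0// le_max lexx.
have tM : M1 < t /\ M2 < t.
  by split; rewrite ltr_pwDr// !le_max lexx ?orbT.
have intg : (@lebesgue_measure R).-integrable `]t, t + 1] (EFin \o g).
  apply: integrableS (continuous_nneg_integrable (t + 1) t0 cg) => //.
  by apply: subset_itvr; rewrite bnd_simp.
pose I := Rintegral lebesgue_measure `]t, (t + 1)] g.
have tt1 : t <= t + 1 by rewrite lerDl.
have FI : Rintegral lebesgue_measure `[0, t + 1] g
    - Rintegral lebesgue_measure `[0, t] g = I.
  apply: Rintegral_itvB; rewrite ?bnd_simp//.
  exact: continuous_nneg_integrable.
have mI (c : R) : Rintegral lebesgue_measure `]t, (t + 1)] (fun=> c) = c.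
  rewrite Rintegral_cst//= lebesgue_measure_itv/= lte_fin ltrDl ltr01.
  by rewrite -EFinB addrAC subrr add0r mulr1.
have intc (c : R) : (@lebesgue_measure R).-integrable `]t, t + 1] (EFin \o (fun=> c)).
  have cc : {within [set t : R | 0 <= t], continuous (fun _ : R => c)}.
    by move=> x; exact: cst_continuous.
  apply: integrableS (continuous_nneg_integrable (t + 1) t0 cc) => //.
  by apply: subset_itvr; rewrite bnd_simp.
have gt s : `]t, (t + 1)]%classic s -> l - e / 3 <= g s <= l + e / 3.
  rewrite /= in_itv /= => /andP[ts _].
  by have := gM s (lt_trans tM.1 ts); rewrite /= ler_norml => /andP[? ?];
    apply/andP; split; lra.
have lI : l - e / 3 <= I.
  by rewrite -[leLHS]mI; apply: le_Rintegral => // s /gt /andP[].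
have Il : I <= l + e / 3.
  by rewrite -[leRHS]mI; apply: le_Rintegral => // s /gt /andP[].
have := FM _ tM.2; have := FM _ (lt_le_trans tM.2 tt1).
rewrite /= !ler_norml => /andP[? ?] /andP[? ?].
by apply/andP; split; lra.
Qed.

Lemma ivp_int_infty (R : realType) (n : nat) (L : {linear 'M[R]_n -> 'M[R]_n})
    (Z0 : 'M[R]_n) (Z : R -> 'M[R]_n) :
  solves_ivp L Z0 Z -> improper_cvg Z -> 0 = Z0 + L (int_infty Z).
Proof.
move=> ivpZ cZ; have intZ : int_to t Z @[t --> +oo] --> int_infty Z by exact: cZ.
have Zlim : Z t @[t --> +oo] --> Z0 + L (int_infty Z).
  have : Z0 + L (int_to t Z) @[t --> +oo] --> Z0 + L (int_infty Z).
    by apply: cvgD; [exact: cvg_cst|exact: cvg_linear].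
  apply: cvg_trans; apply: near_eq_cvg; near=> t.
  by rewrite (ivp_integral ivpZ).
apply/matrixP => i j; rewrite mxE; apply/esym.
apply: (@cvg_integral_lim0 R (fun t => Z t i j) _ (int_infty Z i j)).
- apply: entry_continuous; apply: has_deriv_nneg_continuous.
  exact: ivpZ.2.
- by move/cvg_entries : Zlim.
- move/cvg_entries : intZ => /(_ i j); apply: cvg_trans; apply: near_eq_cvg.
  by near=> t; rewrite mxE.
Unshelve. all: by end_near. Qed.

(** * Cauchy products *)

Lemma triangle_sum (V : nmodType) (F : nat -> nat -> V) (r : nat) :
  \sum_(1 <= i < r) \sum_(1 <= k < i) F k (i - k)%N
  = \sum_(1 <= k < r) \sum_(1 <= j < r | (k + j < r)%N) F k j.
Proof.
have -> : \sum_(1 <= i < r) \sum_(1 <= k < i) F k (i - k)%N =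
    \sum_(1 <= i < r) \sum_(1 <= k < r | (k < i)%N) F k (i - k)%N.
  apply: eq_big_nat => i /andP[_ ir].
  by rewrite (big_nat_widen _ _ _ _ _ (ltnW ir)).
rewrite (exchange_big_dep_nat predT)//=; apply: eq_big_nat => k /andP[k1 kr].
rewrite -[LHS](big_nat_widenl k.+1 1 r predT (fun i => F k (i - k)%N))//.
rewrite -add1n big_addn (big_nat_widen _ _ _ _ _ (leq_subr k r)).
by apply: eq_big => [j|j _]; rewrite ?ltn_subRL// addnK.
Qed.

(** The product of the partial sums of order [r] exceeds the partial Cauchy
    product by the terms with [k + j >= r]. These are dominated by [a k * a j],
    and lie outside the square [k, j < r./2]; so they are bounded by a
    difference of two squares of partial sums of [a], which tends to [0]. *)
Lemma cvg_cauchy_product (R : realType) (x y a : nat -> R) (lx ly la : R) :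
  (forall k, (1 <= k)%N -> `|x k| <= a k) ->
  (forall k, (1 <= k)%N -> `|y k| <= a k) ->
  \sum_(1 <= k < r) x k @[r --> \oo] --> lx ->
  \sum_(1 <= k < r) y k @[r --> \oo] --> ly ->
  \sum_(1 <= k < r) a k @[r --> \oo] --> la ->
  \sum_(1 <= i < r) \sum_(1 <= k < i) x k * y (i - k)%N @[r --> \oo]
    --> lx * ly.
Proof.
move=> xa ya xl yl al.
pose S (u : nat -> R) r := \sum_(1 <= k < r) u k.
have a0 k : (1 <= k)%N -> 0 <= a k by move=> /xa; apply: le_trans.
have square (u v : nat -> R) r :
    S u r * S v r = \sum_(1 <= k < r) \sum_(1 <= j < r) u k * v j.
  by rewrite /S mulr_suml; apply: eq_bigr => k _; rewrite mulr_sumr.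
have half : r./2 @[r --> \oo] --> \oo.
  apply/cvgnyPge => A; exists A.*2 => // r /= Ar.
  by rewrite -(doubleK A); exact: half_leq.
have err0 : S a r * S a r - S a r./2 * S a r./2 @[r --> \oo] --> (0 : R).
  have ah : S a r./2 @[r --> \oo] --> la by exact: cvg_comp half al.
  rewrite -(subrr (la * la)).
  by apply: cvgB; apply: cvgM.
have err r : `|S x r * S y r -
      \sum_(1 <= i < r) \sum_(1 <= k < i) x k * y (i - k)%N|
    <= S a r * S a r - S a r./2 * S a r./2.
  rewrite !square (triangle_sum (fun k j => x k * y j)).
  have split_sum (u v : nat -> R) :
      \sum_(1 <= k < r) \sum_(1 <= j < r) u k * v j =
      \sum_(1 <= k < r) \sum_(1 <= j < r | (k + j < r)%N) u k * v j +
      \sum_(1 <= k < r) \sum_(1 <= j < r | ~~ (k + j < r)%N) u k * v j.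
    rewrite -big_split; apply: eq_bigr => k _ /=.
    exact: (bigID (fun j => k + j < r)%N).
  rewrite split_sum addrAC subrr add0r split_sum.
  apply: (@le_trans _ _
    (\sum_(1 <= k < r) \sum_(1 <= j < r | ~~ (k + j < r)%N) a k * a j)).
    rewrite (le_trans (ler_norm_sum _ _ _))// big_nat_cond [leRHS]big_nat_cond.
    apply: ler_sum => k /andP[/andP[k1 _] _].
    rewrite (le_trans (ler_norm_sum _ _ _))// big_nat_cond [leRHS]big_nat_cond.
    apply: ler_sum => j /andP[/andP[j1 _] _].
    by rewrite normrM ler_pM// ?xa ?ya.
  rewrite addrAC lerDr subr_ge0.
  have hr : (r./2 <= r)%N by rewrite -divn2 leq_div.
  rewrite (big_nat_widen _ _ _ _ _ hr) big_mkcond /= big_nat_cond [leRHS]big_nat_cond.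
  apply: ler_sum => k /andP[/andP[k1 _] _].
  have [kh|_] := ifPn; last first.
    rewrite big_nat_cond sumr_ge0// => j /andP[/andP[j1 _] _].
    by rewrite mulr_ge0// a0.
  rewrite (big_nat_widen _ _ _ _ _ hr) big_mkcond /= [leRHS]big_mkcond /=.
  rewrite big_nat_cond [leRHS]big_nat_cond.
  apply: ler_sum => j /andP[/andP[j1 _] _].
  have [jh|_] := ifPn.
    have -> // : (k + j < r)%N.
    rewrite -[r]odd_double_half -addnn addnA (leq_trans (n := k + r./2))//.
      by rewrite -addnS leq_add2l.
    by rewrite leq_add2r (leq_trans (ltnW kh))// leq_addl.
  by case: ifP => // _; rewrite mulr_ge0// a0.
apply/cvgrPdist_le => e e0.
have xy : S x r * S y r @[r --> \oo] --> lx * ly by exact: cvgM.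
have e20 : 0 < e / 2 by exact: divr_gt0.
near=> r.
have h1 : `|lx * ly - S x r * S y r| <= e / 2.
  by near: r; move/cvgrPdist_le : xy; apply.
have h2 : `|S a r * S a r - S a r./2 * S a r./2| <= e / 2.
  near: r; move/cvgrPdist_le : err0 => /(_ _ e20); apply: filterS => r.
  by rewrite sub0r normrN.
have := err r; have := ler_norm (S a r * S a r - S a r./2 * S a r./2).
set C := (\sum_(1 <= i < r) _) => h3 h4.
have -> : lx * ly - C = (lx * ly - S x r * S y r) + (S x r * S y r - C).
  by rewrite addrA subrK.
rewrite (le_trans (ler_normD _ _))//.
move: h1 h2 h3 h4; lra.
Unshelve. all: by end_near. Qed.

Lemma cvg_trace (R : realType) (n : nat) (T : Type) (F : set_system T)
    {FF : Filter F} (f : T -> 'M[R]_n) (X : 'M[R]_n) :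
  f x @[x --> F] --> X -> \tr (f x) @[x --> F] --> \tr X.
Proof.
move=> /cvg_entries fX.
by apply: cvg_big => [x|i _]; [exact: add_continuous|exact: fX].
Qed.

Lemma cvg_tens_cauchy_product (R : realType) (n : nat) (X : nat -> 'M[R]_n)
    (P : 'M[R]_n) :
  (forall i, (1 <= i)%N -> psd (X i)) ->
  \sum_(1 <= i < r) X i @[r --> \oo] --> P ->
  \sum_(1 <= i < r) \sum_(1 <= k < i) X k *t X (i - k)%N @[r --> \oo]
    --> P *t P.
Proof.
move=> pX XP; apply/cvg_entries => i j; rewrite mxE.
have XPij a b : \sum_(1 <= k < r) X k a b @[r --> \oo] --> P a b.
  by move/cvg_entries : XP => /(_ a b); under eq_cvg do rewrite summxE.
have trP : \sum_(1 <= k < r) \tr (X k) @[r --> \oo] --> \tr P.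
  by move/cvg_trace : XP; under eq_cvg do rewrite linear_sum.
have dom a b k : (1 <= k)%N -> `|X k a b| <= \tr (X k).
  by move=> /pX; exact: psd_le_trace.
under eq_cvg => r.
  rewrite summxE; under eq_bigr => l _.
    rewrite summxE; under eq_bigr do rewrite mxE.
    over.
  over.
exact: cvg_cauchy_product (dom _ _) (dom _ _) (XPij _ _) (XPij _ _) trP.
Qed.

(** * The Gramian *)

Definition kron_congr (R : comPzRingType) (n : nat) (H : 'I_n -> 'M[R]_n) :
    {linear 'M[R]_(n * n) -> 'M[R]_n} :=
  mulmxr (block_row H)^T \o mulmx (block_row H).

(** For [i = 1] the inner sum is empty and for [i >= 2] the first term vanishes,
    so one formula covers all initial values. *)
Lemma Z_family_ivp (R : realType) (n m : nat) (A : 'M[R]_n)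
    (B : 'M[R]_(n, m)) (N : 'I_m -> 'M[R]_n) (H : 'I_n -> 'M[R]_n)
    (J : (R -> 'M[R]_n) -> 'M[R]_n) (Z : nat -> R -> 'M[R]_n) :
  Z_family A B N H J Z -> forall i, (1 <= i)%N ->
  solves_ivp (lyap A N)
    ((i == 1%N)%:R *: (B *m B^T)
     + kron_congr H (\sum_(1 <= k < i) J (Z k) *t J (Z (i - k)%N))) (Z i).
Proof.
move=> [Z1 Zi] [|[|i]] // _.
  by rewrite big_geq// linear0 addr0 scale1r.
by rewrite scale0r add0r; exact: Zi.
Qed.

(** Strong induction on [i]: the initial value of [Z i] involves only the
    [J (Z k)] with [k < i]. Both kinds of integrals satisfy the hypothesis on
    [J]. *)
Lemma Z_family_psd (R : realType) (n m : nat) (A : 'M[R]_n)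
    (B : 'M[R]_(n, m)) (N : 'I_m -> 'M[R]_n) (H : 'I_n -> 'M[R]_n)
    (J : (R -> 'M[R]_n) -> 'M[R]_n) (Z : nat -> R -> 'M[R]_n) :
  Z_family A B N H J Z ->
  (forall i, (1 <= i)%N -> {within [set t : R | 0 <= t], continuous (Z i)} ->
     (forall t, 0 <= t -> psd (Z i t)) -> psd (J (Z i))) ->
  forall i, (1 <= i)%N -> psd (J (Z i)).
Proof.
move=> famZ pJ; elim/ltn_ind => i IH i1.
have ivpZ := Z_family_ivp famZ i1.
apply: pJ => //; first exact: has_deriv_nneg_continuous ivpZ.2.
apply: (psd_flow ivpZ); apply: psdD.
  by apply: psdZ; [exact: ler0n|exact: psd_gram].
apply: psd_congr; rewrite big_nat_cond; apply: psd_sum => k.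
move=> /andP[/andP[k1 ki] _].
by apply: psd_tens; apply: IH; lia.
Qed.

(** [E i] stands for the final value of [Z i]: it is [Z i T] for the integral
    over [[0, T]], and the limit [0] for the integral over the half-line. *)
Lemma Z_family_sum (R : realType) (n m : nat) (A : 'M[R]_n)
    (B : 'M[R]_(n, m)) (N : 'I_m -> 'M[R]_n) (H : 'I_n -> 'M[R]_n)
    (J : (R -> 'M[R]_n) -> 'M[R]_n) (Z : nat -> R -> 'M[R]_n)
    (E : nat -> 'M[R]_n) :
  (forall i, (1 <= i)%N -> psd (J (Z i))) ->
  (forall i, (1 <= i)%N ->
     E i = (i == 1%N)%:R *: (B *m B^T)
       + kron_congr H (\sum_(1 <= k < i) J (Z k) *t J (Z (i - k)%N))
       + lyap A N (J (Z i))) ->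
  cvg_series1 (fun i => J (Z i)) ->
  let P := gramian J Z in
  \sum_(1 <= i < r) E i @[r --> \oo] -->
    B *m B^T + block_row H *m (P *t P) *m (block_row H)^T + lyap A N P.
Proof.
move=> pJ EE cJ P.
have JP : \sum_(1 <= i < r) J (Z i) @[r --> \oo] --> P by exact: cJ.
have Hsum : kron_congr H (\sum_(1 <= i < r) \sum_(1 <= k < i)
    J (Z k) *t J (Z (i - k)%N)) @[r --> \oo] --> kron_congr H (P *t P).
  by apply: cvg_linear; exact: cvg_tens_cauchy_product.
have Lsum : lyap A N (\sum_(1 <= i < r) J (Z i)) @[r --> \oo] --> lyap A N P.
  exact: cvg_linear.
have BHL : B *m B^T + kron_congr H (\sum_(1 <= i < r) \sum_(1 <= k < i)
      J (Z k) *t J (Z (i - k)%N)) + lyap A N (\sum_(1 <= i < r) J (Z i))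
    @[r --> \oo] --> B *m B^T + kron_congr H (P *t P) + lyap A N P.
  by apply: cvgD => //; apply: cvgD => //; exact: cvg_cst.
apply: cvg_trans BHL; apply: near_eq_cvg; near=> r.
rewrite [kron_congr H _]linear_sum [lyap A N _]linear_sum.
have -> : B *m B^T = \sum_(1 <= i < r) (i == 1%N)%:R *: (B *m B^T).
  rewrite big_ltn; last by near: r; exact: nbhs_infty_gt.
  rewrite eqxx scale1r big_nat_cond big1 ?addr0// => i /andP[/andP[i2 _] _].
  by rewrite gtn_eqF// scale0r.
rewrite -!big_split /=; apply: eq_big_nat => i /andP[i1 _].
by rewrite EE.
Unshelve. all: by end_near. Qed.

Theorem proposition2p18 (R : realType) (n m : nat) (T : R) (hT : 0 < T)
    (A : 'M[R]_n) (B : 'M[R]_(n, m))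
    (N : 'I_m -> 'M[R]_n) (H : 'I_n -> 'M[R]_n) :
  (forall Z : nat -> R -> 'M[R]_n,
     Z_family A B N H (int_to T) Z ->
     gramian_T_exists T Z ->
     let P := gramian (int_to T) Z in
     cvg_series1 (fun i => Z i T) /\
     sum_series1 (fun i => Z i T) - B *m B^T
       = lyap A N P + block_row H *m (P *t P) *m (block_row H)^T)
  /\
  (forall Z : nat -> R -> 'M[R]_n,
     Z_family A B N H (@int_infty R n n) Z ->
     spectrum (lyap_kron A N) `<=` @open_left_half_plane R ->
     gramian_infty_exists Z ->
     let P := gramian (@int_infty R n n) Z in
     - (B *m B^T)
       = lyap A N P + block_row H *m (P *t P) *m (block_row H)^T).
Proof.
have hausM : hausdorff_space 'M[R]_n by exact: norm_hausdorff.
split=> [Z famZ exP P|Z famZ _ [cvgZ exP] P].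
  have psdX := Z_family_psd famZ (fun i _ => @psd_int_to _ _ (Z i) T).
  have sumZ := Z_family_sum psdX
    (fun i i1 => ivp_integral (Z_family_ivp famZ i1) hT) exP.
  split; first by apply/cvg_ex; eexists; exact: sumZ.
  rewrite /sum_series1 (cvg_lim hausM sumZ).
  by rewrite -[X in X - _]addrA [X in X - _]addrC addrK addrC.
have psd_lim i : (1 <= i)%N ->
    {within [set t : R | 0 <= t], continuous (Z i)} ->
    (forall t, 0 <= t -> psd (Z i t)) -> psd (int_infty (Z i)).
  move=> i1 cZ pZ; apply: psd_cvg (cvgZ i i1).
  by near=> t; exact: psd_int_to.
have psdX := Z_family_psd famZ psd_lim.
have sum0 := Z_family_sum psdX
  (fun i i1 => ivp_int_infty (Z_family_ivp famZ i1) (cvgZ i i1)) exP.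
have : 0 = B *m B^T + block_row H *m (P *t P) *m (block_row H)^T + lyap A N P.
  have c0 : \sum_(1 <= i < r) (0 : 'M[R]_n) @[r --> \oo] --> (0 : 'M[R]_n).
    by under eq_cvg do rewrite big1_eq; exact: cvg_cst.
  exact: (cvg_unique hausM c0 sum0).
move=> /esym/eqP; rewrite -addrA addr_eq0 => /eqP ->.
by rewrite opprK addrC.
Unshelve. all: by end_near. Qed.
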